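(* If all arms have the same prior mean reward, $\mathbb E[\mu_1]=\mathbb E[\mu_2]=\dots=\mathbb E[\mu_K]$, then Thompson sampling (run from the first round) is BIC.
   Context: Incentivized exploration model: $K$ arms; mean rewards $\mu_1,\dots,\mu_K\in[0,1]$ drawn independently, $\mu_i\sim\mathcal P_i$ with known priors. Rewards are Bernoulli: given the means, each arm $i$ has an i.i.d. sequence of $\{0,1\}$ samples with mean $\mu_i$, the $n$-th choice of arm $i$ reveals its $n$-th sample. In each round $t$ the algorithm recommends $A_t$, the agent chooses $A'_t$, and the reward is observed by the algorithm. With $\mathcal E_{t-1}=\{A'_s=A_s\ \forall s<t\}$, the algorithm is BIC if for all $t$ and all arms $i,j$ with $\Pr[A_t=i]>0$, $\mathbb E[\mu_i-\mu_j\mid A_t=i,\mathcal E_{t-1}]\geq0$. $A^*=\min(\arg\max_j\mu_j)$; $\mathcal F_t$ is the $\sigma$-algebra of chosen arms and rewards before round $t$. Thompson sampling recommends in round $t$ an arm $A_t$ with $\Pr[A_t=i\mid\mathcal F_t]=\Pr[A^*=i\mid\mathcal F_t]$ (a posterior sample of $A^*$). *)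

(* Defs.v *)
From HB Require Import structures.
From mathcomp Require Import all_boot all_order all_algebra.
From mathcomp Require Import all_classical all_reals all_analysis.
Set Implicit Arguments. Unset Strict Implicit. Unset Printing Implicit Defensive.
Import Order.TTheory GRing.Theory Num.Theory.
Local Open Scope classical_set_scope.
Local Open Scope ring_scope.

(* Rounds are 0-indexed: round t (Rocq) = round t+1 (paper); the history
   before round t consists of rounds 0 .. t-1. *)
Section Bandit.
Variables (d : measure_display) (T : measurableType d) (R : realType) (K : nat).
Variables (mu : 'I_K -> T -> R) (X : 'I_K -> nat -> T -> bool)
          (A : nat -> T -> 'I_K).

Definition npulls (t : nat) (w : T) : nat :=
  count (fun s => A s w == A t w) (iota 0 t).

(* the n-th choice of arm i reveals its n-th sample X i n *)
Definition reward (t : nat) (w : T) : bool := X (A t w) (npulls t w) w.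

Definition history (t : nat) (w : T) : seq ('I_K * bool) :=
  [seq (A s w, reward s w) | s <- iota 0 t].

Definition is_best (w : T) (i : 'I_K) : Prop :=
  (forall j, mu j w <= mu i w) /\ (forall j : 'I_K, (j < i)%N -> mu j w < mu i w).

Definition cylinder (B : 'I_K -> set R) (S : seq ('I_K * nat))
    (x : 'I_K -> nat -> bool) : set T :=
  [set w | (forall k, B k (mu k w)) /\ (forall p, p \in S -> X p.1 p.2 w = x p.1 p.2)].
End Bandit.

Definition cond_exp_event (d : measure_display) (T : measurableType d)
    (R : realType) (P : probability T R) (Y : T -> R) (B : set T) : R :=
  fine (\int[P]_(w in B) (Y w)%:E) / fine (P B).

(* Main.v *)
Require Import Defs.
From HB Require Import structures.
From mathcomp Require Import all_boot all_order all_algebra.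
From mathcomp Require Import all_classical all_reals all_analysis.
From mathcomp Require Import measurable_realfun ring lra.
Import Order.TTheory GRing.Theory Num.Theory.
Local Open Scope classical_set_scope.
Local Open Scope ring_scope.

(** Since the recommendation is a posterior sample, E[(mu_i - mu_j) 1{A_t = i}]
    is the expectation of Q_t M_t, where Q_t is the posterior probability that i
    is best and M_t the posterior mean of mu_i - mu_j.  Both are martingales and
    Q_0 M_0 = 0, so it suffices that their increments are nonnegatively
    correlated.  Given the history the means stay independent, with density
    proportional to the likelihood of the revealed samples, and observing arm a
    moves the posterior mean of f proportionally to the posterior covariance
    Cov(mu_a, f).  If a = i, then mu_i correlates nonnegatively with both mu_i -
    mu_j and {i is best}; if a = j, nonpositively with both; otherwise
    Cov(mu_a, mu_i - mu_j) = 0. *)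

(** * Expectations of bounded measurable functions *)

(** The hypotheses on samples and recommendations speak of cylinder events only, whereas the
    argument needs the event that an arm is best and products of means. Identities linear in a test
    function are therefore put in the form E[f g] = 0 and extended from rectangles by
    [ex_orthogonal_measurable]. No conditional expectation is formed: [lex h f] integrates [f]
    against the likelihood, so a posterior mean is a ratio of two such integrals and a posterior
    covariance appears multiplied by the squared mass. Null histories are treated apart or absorbed
    by x / 0 = 0. One covariance governs each update because rewards are binary. If m is the
    posterior mean of mu_a, a reward 1 shifts the posterior mean of f by Cov(mu_a, f) / m and a
    reward 0 shifts it by - Cov(mu_a, f) / (1 - m). For two functions f and g, the product of the
    shifts thus has the sign of Cov(mu_a, f) Cov(mu_a, g) after either reward. *)

Section Expectation.
Set Implicit Arguments.
Unset Strict Implicit.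
Context (d : measure_display) (T : measurableType d) (R : realType).
Variable P : probability T R.

Definition ex (f : T -> R) : R := \int[P]_w f w.

Definition bounded_mfun (f : T -> R) : Prop :=
  measurable_fun setT f /\ exists M, forall w, `|f w| <= M.

Lemma bm_cst c : bounded_mfun (fun=> c).
Proof. by split; [exact: measurable_cst | exists `|c|]. Qed.

Lemma bm_indic D : measurable D -> bounded_mfun \1_D.
Proof.
move=> mD; split; first exact: measurable_indic.
by exists 1 => w; rewrite indicE; case: (_ \in _); rewrite ?normr1 ?normr0.
Qed.

Lemma bmD f g : bounded_mfun f -> bounded_mfun g ->
  bounded_mfun (fun w => f w + g w).
Proof.
move=> [mf [M hM]] [mg [N hN]]; split; first exact: measurable_funD.
by exists (M + N) => w; apply: le_trans (ler_normD _ _) _; exact: lerD.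
Qed.

Lemma bmM f g : bounded_mfun f -> bounded_mfun g ->
  bounded_mfun (fun w => f w * g w).
Proof.
move=> [mf [M hM]] [mg [N hN]]; split; first exact: measurable_funM.
by exists (M * N) => w; rewrite normrM; exact: ler_pM.
Qed.

Lemma bmB f g : bounded_mfun f -> bounded_mfun g ->
  bounded_mfun (fun w => f w - g w).
Proof.
move=> bf bg; have -> : (fun w => f w - g w) = (fun w => f w + -1 * g w).
  by apply/funext => w; rewrite mulN1r.
by apply: bmD => //; apply: bmM => //; exact: bm_cst.
Qed.

Lemma bm_integrable f : bounded_mfun f -> P.-integrable setT (EFin \o f).
Proof.
move=> [mf [M hM]]; apply: measurable_bounded_integrable => //.
  by apply: le_lt_trans (probability_le1 P measurableT) _; exact: ltry.
by exists M; split; [exact: num_real | move=> x Mx w _; exact: le_trans (hM w) (ltW Mx)].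
Qed.

Lemma ex_cst c : ex (fun=> c) = c.
Proof. rewrite /ex Rintegral_cst// -[RHS]mulr1; congr (_ * _).
exact: (congr1 fine (probability_setT P)). Qed.

Lemma exD f g : bounded_mfun f -> bounded_mfun g ->
  ex (fun w => f w + g w) = ex f + ex g.
Proof. by move=> bf bg; apply: RintegralD => //; exact: bm_integrable. Qed.

Lemma exB f g : bounded_mfun f -> bounded_mfun g ->
  ex (fun w => f w - g w) = ex f - ex g.
Proof. by move=> bf bg; apply: RintegralB => //; exact: bm_integrable. Qed.

Lemma exZ c f : bounded_mfun f -> ex (fun w => c * f w) = c * ex f.
Proof. by move=> bf; apply: RintegralZl => //; exact: bm_integrable. Qed.

Lemma ex_le f g : bounded_mfun f -> bounded_mfun g ->
  (forall w, f w <= g w) -> ex f <= ex g.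
Proof. by move=> bf bg fg; apply: le_Rintegral => //; exact: bm_integrable. Qed.

Lemma ex_ge0 f : (forall w, 0 <= f w) -> 0 <= ex f.
Proof. by move=> f0; exact: Rintegral_ge0. Qed.

Lemma bm_sum (I : Type) (s : seq I) (F : I -> T -> R) :
  (forall i, bounded_mfun (F i)) -> bounded_mfun (fun w => \sum_(i <- s) F i w).
Proof.
move=> bF; elim: s => [|i s IH].
  by under eq_fun do rewrite big_nil; exact: bm_cst.
by under eq_fun do rewrite big_cons; exact: bmD.
Qed.

Lemma ex_sum (I : Type) (s : seq I) (F : I -> T -> R) :
  (forall i, bounded_mfun (F i)) ->
  ex (fun w => \sum_(i <- s) F i w) = \sum_(i <- s) ex (F i).
Proof.
move=> bF; elim: s => [|i s IH].
  by under eq_fun do rewrite big_nil; rewrite ex_cst big_nil.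
under eq_fun do rewrite big_cons; rewrite exD// ?IH ?big_cons//; exact: bm_sum.
Qed.

Lemma ex_indic (D : set T) : measurable D -> ex \1_D = fine (P D).
Proof. by move=> mD; rewrite /ex /Rintegral integral_indic// setIT. Qed.

Lemma ex_mul_indic f (D : set T) : ex (fun w => f w * \1_D w) = \int[P]_(w in D) f w.
Proof.
rewrite /ex [RHS]Rintegral_mkcond; apply: eq_Rintegral => w _.
by rewrite patchE indicE; case: (_ \in _); rewrite ?mulr1 ?mulr0.
Qed.

(** Dynkin's pi-lambda theorem: the measurable sets over which [f] integrates to zero are closed
    under disjoint countable unions, and under complements because [G] contains the whole space. *)
Lemma ex_orthogonal_sigma_algebra (G : set (set T)) (f : T -> R) :
  setI_closed G -> G setT -> G `<=` measurable -> bounded_mfun f ->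
  (forall D, G D -> ex (fun w => f w * \1_D w) = 0) ->
  forall D, <<s G >> D -> ex (fun w => f w * \1_D w) = 0.
Proof.
move=> GI GT Gm bf fG.
have intf D : measurable D -> P.-integrable D (EFin \o f).
  by move=> mD; apply: integrableS (bm_integrable bf).
have fin D : measurable D -> (\int[P]_(w in D) (f w)%:E)%E \is a fin_num.
  by move=> mD; apply: integrable_fin_num => //; exact: intf.
suff: <<s G >> `<=` [set D | measurable D /\ (\int[P]_(w in D) (f w)%:E = 0)%E].
  by move=> H D /H[mD h0]; rewrite ex_mul_indic /Rintegral h0.
have GH D : G D -> measurable D /\ (\int[P]_(w in D) (f w)%:E = 0)%E.
  move=> GD; have mD := Gm _ GD; split => //.
  by rewrite -[LHS]fineK ?fin//; have := fG _ GD; rewrite ex_mul_indic /Rintegral => ->.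
apply: lambda_system_subset; [exact: GI| |exact: GH|by []].
apply/dynkin_lambda_system; split; first exact: GH.
- move=> D [mD D0]; split; first exact: measurableC.
  have [_ T0] := GH _ GT.
  have disj : [disjoint D & ~` D] by apply/disj_setPS; rewrite setICr.
  have mf : measurable_fun (D `|` ~` D) (EFin \o f).
    by rewrite setUv; apply/measurable_EFinP; case: bf.
  have := integral_setU P mD (measurableC mD) mf disj.
  by rewrite setUv /= D0 T0 add0e.
- move=> F tF mF; split; first by apply: bigcup_measurable => k _; case: (mF k).
  rewrite integral_bigcup//.
  + by rewrite eseries0// => k _ _; case: (mF k).
  + by move=> k; case: (mF k).
  + by apply: intf; apply: bigcup_measurable => k _; case: (mF k).
Qed.
End Expectation.

(** The sum counts the integers 1, ..., n not exceeding [y], so it is the floor of [y]. It serves to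
    approximate a function by indicators of its superlevel sets with a uniform error of at most
    1. *)
Lemma sum_threshold_bounds (R : realDomainType) (y : R) (n : nat) :
  0 <= y -> y <= n%:R ->
  y - 1 <= \sum_(k < n) (k.+1%:R <= y)%R%:R <= y.
Proof.
move=> y0 yn.
(* Either all thresholds so far are passed, or one has failed; then all later ones fail too and the
   sum stays put. *)
have H m : let s := \sum_(k < m) (k.+1%:R <= y)%R%:R in
    (s = m%:R /\ m%:R <= y) \/ (y < m%:R /\ y - 1 <= s <= y).
  elim: m => [|m] /=; first by left; rewrite big_ord0.
  rewrite big_ord_recr /=; set s := \sum_(_ < _) _.
  have m1 : m.+1%:R = m%:R + 1 :> R by rewrite -natr1.
  case=> [[-> my]|[ym sy]].
    by case: (leP (m.+1%:R) y) => h /=; rewrite ?mulr1n ?mulr0n; [left|right]; split; rewrite ?m1; lra.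
  have -> : (m.+1%:R <= y) = false by apply/negbTE; rewrite -ltNge m1; lra.
  by right; rewrite m1 mulr0n; split; lra.
by case: (H n) => [[-> ny]|[_]] //; lra.
Qed.

(** * Orthogonality: from a pi-system to measurable functions *)

Section OrthogonalMeasurable.
Set Implicit Arguments.
Unset Strict Implicit.
Context (d : measure_display) (T : measurableType d) (R : realType).
Variable P : probability T R.
Local Notation ex := (ex P).

Lemma bm_sub_sigma (G : set (set T)) (g : T -> R) :
  G `<=` measurable ->
  measurable_fun (setT : set (g_sigma_algebraType G)) g ->
  measurable_fun (setT : set T) g.
Proof.
move=> Gm mg _ C mC.
have := mg measurableT C mC.
exact: smallest_sub (@sigma_algebra_measurable _ T) Gm _.
Qed.

(** Replacing (n+1) [g] by a sum of indicators of sets in the generated sigma-algebra, each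
    orthogonal to [f], costs at most 1 pointwise. Hence (n+1) |E[f g]| is at most the bound of |f|
    for every n, which forces E[f g] = 0. *)
Lemma ex_orthogonal_measurable (G : set (set T)) (f g : T -> R) :
  setI_closed G -> G setT -> G `<=` measurable -> bounded_mfun f ->
  (forall D, G D -> ex (fun w => f w * \1_D w) = 0) ->
  measurable_fun (setT : set (g_sigma_algebraType G)) g ->
  (forall w, 0 <= g w <= 1) ->
  ex (fun w => f w * g w) = 0.
Proof.
move=> GI GT Gm bf fG mg g01.
have bg : bounded_mfun g.
  split; first exact: bm_sub_sigma mg.
  by exists 1 => w; have /andP[g0 g1] := g01 w; rewrite ger0_norm.
have [M hM] := bf.2.
pose D (n k : nat) : set T := [set w | k.+1%:R <= n.+1%:R * g w].
have GD n k : <<s G >> (D n k).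
  have := mg measurableT `[k.+1%:R / n.+1%:R, +oo[%classic (measurable_itv _).
  rewrite setTI; congr (<<s G >> _); apply/seteqP; split => w /=;
    by rewrite /D /= in_itv /= andbT ler_pdivrMr ?ltr0n // mulrC.
have mD n k : measurable (D n k).
  by apply: smallest_sub (GD n k); [exact: sigma_algebra_measurable|].
pose gn n w := \sum_(k < n.+1) \1_(D n k) w : R.
have bgn n : bounded_mfun (gn n) by apply: bm_sum => k; exact: bm_indic.
have fgn n : ex (fun w => f w * gn n w) = 0.
  rewrite /gn; under eq_fun do rewrite mulr_sumr.
  rewrite ex_sum; last by move=> k; apply: bmM => //; exact: bm_indic.
  by rewrite big1// => k _; exact: (ex_orthogonal_sigma_algebra GI GT Gm bf fG (GD n k)).
have key n : n.+1%:R * `|ex (fun w => f w * g w)| <= M.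
  have -> : n.+1%:R * `|ex (fun w => f w * g w)| =
      `|ex (fun w => f w * (n.+1%:R * g w - gn n w))|.
    rewrite -[X in X * `|_|]ger0_norm// -normrM -exZ; last exact: bmM.
    rewrite -[X in `|X|]subr0 -(fgn n) -exB; last 2 first.
    - by apply: bmM; [exact: bm_cst|exact: bmM].
    - exact: bmM.
    by congr (`|ex _|); apply/funext => w; ring.
  have bh : bounded_mfun (fun w => f w * (n.+1%:R * g w - gn n w)).
    by apply: bmM => //; apply: bmB => //; apply: bmM => //; exact: bm_cst.
  have hle w : `|f w * (n.+1%:R * g w - gn n w)| <= M.
    rewrite normrM -[M]mulr1; apply: ler_pM => //.
    have /andP[g0 g1] := g01 w.
    have := @sum_threshold_bounds R (n.+1%:R * g w) n.+1.
    have -> : \sum_(k < n.+1) (k.+1%:R <= n.+1%:R * g w)%R%:R = gn n w.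
      apply: eq_bigr => k _; rewrite indicE; congr (_%:R); congr nat_of_bool.
      by apply/idP/idP => [h|/set_mem //]; exact/mem_set.
    move=> /(_ (mulr_ge0 (ler0n _ _) g0)) /(_ (ler_piMr (ler0n _ _) g1)).
    by rewrite ler_norml; lra.
  rewrite ler_norml; apply/andP; split.
    rewrite -[X in X <= _](ex_cst P); apply: ex_le => //; first exact: bm_cst.
    by move=> w; have := hle w; rewrite ler_norml => /andP[].
  rewrite -[X in _ <= X](ex_cst P); apply: ex_le => //; first exact: bm_cst.
  by move=> w; have := hle w; rewrite ler_norml => /andP[].
apply/eqP; rewrite -normr_le0 leNgt; apply/negP => x0.
have := key (Num.truncn (M / `|ex (fun w => f w * g w)|)).
by rewrite -ler_pdivlMr// leNgt truncnS_gt.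
Qed.
End OrthogonalMeasurable.

(** * Functions of a subset of the means *)

Section ArmSigmaAlgebra.
Set Implicit Arguments.
Unset Strict Implicit.
Context (d : measure_display) (T : measurableType d) (R : realType) (K : nat).
Variable mu : 'I_K -> T -> R.
Hypothesis mu_meas : forall i, measurable_fun setT (mu i).

Definition rectangle (B : 'I_K -> set R) : set T :=
  [set w | forall k, B k (mu k w)].

(** The pi-system generating the sigma-algebra of the means of the arms in [J]; measurability for it
    expresses being a function of these means alone. *)
Definition rectangles (J : pred 'I_K) : set (set T) :=
  [set D | exists2 B : 'I_K -> set R,
     (forall k, measurable (B k)) /\ (forall k, ~~ J k -> B k = setT) &
     D = rectangle B].

Definition arm_measurable (J : pred 'I_K) (g : T -> R) : Prop :=
  measurable_fun (setT : set (g_sigma_algebraType (rectangles J))) g.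

(** The measurable space is arbitrary so that the lemma also applies to [T] equipped with the
    sigma-algebra of a subset of the arms. *)
Lemma measurable_forall_ord d' (T' : measurableType d') (Q : 'I_K -> set T') :
  (forall k, measurable (Q k)) -> measurable [set w | forall k, Q k w].
Proof.
move=> mQ; have -> : [set w | forall k, Q k w] = \bigcap_(k in setT) Q k.
  by apply/seteqP; split => w /=; [move=> h k _; exact: h | move=> h k; exact: h].
by apply: fin_bigcap_measurable => //; exact: finite_finset.
Qed.

Lemma measurable_imply d' (T' : measurableType d') (b : bool) (Q : set T') :
  (b -> measurable Q) -> measurable [set w | b -> Q w].
Proof.
case: b => mQ.
  have -> : [set w | true -> Q w] = Q by apply/seteqP; split => w /=; [exact|].
  exact: mQ.
have -> : [set w | false -> Q w] = setT by apply/seteqP; split.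
exact: measurableT.
Qed.

Lemma measurable_rectangle B : (forall k, measurable (B k)) ->
  measurable (rectangle B).
Proof.
move=> mB; apply: (measurable_forall_ord (Q := fun k => mu k @^-1` B k)) => k.
by rewrite -[X in measurable X]setTI; exact: mu_meas.
Qed.

Lemma rectangle_setT : rectangle (fun=> setT) = setT.
Proof. by apply/seteqP; split. Qed.

Lemma rectangleI B C : rectangle B `&` rectangle C = rectangle (fun k => B k `&` C k).
Proof.
by apply/seteqP; split => w /=; [case=> hB hC k; split; [exact: hB|exact: hC]
  |move=> h; split => k; have [] := h k].
Qed.

Lemma rectanglesT J : rectangles J setT.
Proof. by exists (fun=> setT); rewrite ?rectangle_setT. Qed.

Lemma rectangles_setI J : setI_closed (rectangles J).
Proof.
move=> _ _ [B [mB JB] ->] [C [mC JC] ->]; rewrite rectangleI.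
exists (fun k => B k `&` C k) => //; split => k; first exact: measurableI.
by move=> nJ; rewrite JB// JC// setIT.
Qed.

Lemma rectangles_measurable J : rectangles J `<=` measurable.
Proof. by move=> _ [B [mB _] ->]; exact: measurable_rectangle. Qed.

Lemma arm_measurable_mu (J : pred 'I_K) k : J k -> arm_measurable J (mu k).
Proof.
move=> Jk _ C mC; rewrite setTI; apply: sub_sigma_algebra.
exists (fun l => if l == k then C else setT).
  split=> l; first by case: eqP.
  by case: eqP => [->|//]; rewrite Jk.
apply/seteqP; split => w /=; last by move=> /(_ k); rewrite eqxx.
by move=> Cw l; case: eqP => [->|].
Qed.

Lemma arm_measurable_bm J g : arm_measurable J g -> (forall w, 0 <= g w <= 1) ->
  bounded_mfun g.
Proof.
move=> mg g01; split; first exact: bm_sub_sigma (@rectangles_measurable J) mg.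
by exists 1 => w; have /andP[g0 g1] := g01 w; rewrite ger0_norm.
Qed.

Lemma arm_measurable_indic J (D : set T) : <<s rectangles J>> D ->
  arm_measurable J \1_D.
Proof. by move=> mD; exact: (@measurable_indic _ (g_sigma_algebraType (rectangles J)) R setT D). Qed.

Lemma arm_measurable_le J (f g : T -> R) : arm_measurable J f -> arm_measurable J g ->
  <<s rectangles J>> [set w | f w <= g w].
Proof.
move=> mf mg; rewrite -[[set w | _]]setTI.
exact: (@measurable_fun_le _ (g_sigma_algebraType (rectangles J)) R setT).
Qed.

Lemma arm_measurable_lt J (f g : T -> R) : arm_measurable J f -> arm_measurable J g ->
  <<s rectangles J>> [set w | f w < g w].
Proof.
move=> mf mg; have -> : [set w | f w < g w] = ~` [set w | g w <= f w].
  by apply/seteqP; split => w /=; rewrite ltNge => /negP.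
by apply: sigma_algebraC; exact: arm_measurable_le.
Qed.

Lemma arm_measurable_forall J (b : pred 'I_K) (Q : 'I_K -> set T) :
  (forall k, b k -> <<s rectangles J>> (Q k)) ->
  <<s rectangles J>> [set w | forall k, b k -> Q k w].
Proof.
move=> mQ.
apply: (@measurable_forall_ord _ (g_sigma_algebraType (rectangles J))
  (fun k => [set w | b k -> Q k w])) => k.
by apply: (@measurable_imply _ (g_sigma_algebraType (rectangles J))) => /mQ.
Qed.

Lemma arm_measurable_best (J : pred 'I_K) i : (forall k, J k) ->
  <<s rectangles J>> [set w | is_best mu w i].
Proof.
move=> allJ.
have -> : [set w | is_best mu w i] =
    [set w | forall k, true -> mu k w <= mu i w] `&`
    [set w | forall k : 'I_K, (k < i)%N -> mu k w < mu i w].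
  apply/seteqP; split => w /= [h1 h2]; split => // k; exact: h1.
apply: (@measurableI _ (g_sigma_algebraType (rectangles J)));
  apply: arm_measurable_forall => k ?.
- by apply: arm_measurable_le; exact: arm_measurable_mu.
- by apply: arm_measurable_lt; exact: arm_measurable_mu.
Qed.

End ArmSigmaAlgebra.

(** * Independence of functions of disjoint sets of arms *)

Section Independence.
Set Implicit Arguments.
Unset Strict Implicit.
Context (d : measure_display) (T : measurableType d) (R : realType) (K : nat).
Variables (P : probability T R) (mu : 'I_K -> T -> R).
Hypothesis mu_meas : forall i, measurable_fun setT (mu i).
Hypothesis mu_indep : forall B : 'I_K -> set R, (forall k, measurable (B k)) ->
  fine (P [set w | forall k, B k (mu k w)]) =
  \prod_(k < K) fine (P [set w | B k (mu k w)]).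
Local Notation ex := (ex P).
Local Notation arm_measurable := (arm_measurable mu).

Lemma ex_centered_mul_indic (f : T -> R) (D : set T) c :
  measurable D -> bounded_mfun f ->
  ex (fun w => (f w - c) * \1_D w) = ex (fun w => f w * \1_D w) - c * fine (P D).
Proof.
move=> mD bf; rewrite -ex_indic// -exZ; last exact: bm_indic.
rewrite -exB; first by congr ex; apply/funext => w; rewrite mulrBl.
- by apply: bmM => //; exact: bm_indic.
- by apply: bmM; [exact: bm_cst|exact: bm_indic].
Qed.

(** Each arm is constrained by at most one of the two rectangles, so in the product formula one of
    its two factors is 1. *)
Lemma prob_rectangleI (J : pred 'I_K) (D E : set T) :
  rectangles mu J D -> rectangles mu (predC J) E ->
  fine (P (D `&` E)) = fine (P D) * fine (P E).
Proof.
move=> [B [mB JB] ->] [C [mC JC] ->]; rewrite rectangleI.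
rewrite /rectangle (mu_indep (B := fun k => B k `&` C k)); last first.
  by move=> k; exact: measurableI.
rewrite !mu_indep// -big_split /=; apply: eq_bigr => k _.
have PT : fine (P [set w | [set: R] (mu k w)]) = 1.
  exact: (congr1 fine (probability_setT P)).
have [Jk|nJk] := boolP (J k).
  have nJ : ~~ predC J k by rewrite /= negbK.
  rewrite (JC k nJ) PT mulr1; congr (fine (P _)).
  by apply/seteqP; split => w /=; [case|].
rewrite (JB k nJk) PT mul1r; congr (fine (P _)).
by apply/seteqP; split => w /=; [case|].
Qed.

(** The orthogonality principle is used once per factor: first a centred indicator of a rectangle in
    the arms outside [J] is tested against [f], then the centred [f] is tested against [g]. *)
Lemma ex_arm_indep (J : pred 'I_K) (f g : T -> R) :
  arm_measurable J f -> (forall w, 0 <= f w <= 1) ->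
  arm_measurable (predC J) g -> (forall w, 0 <= g w <= 1) ->
  ex (fun w => f w * g w) = ex f * ex g.
Proof.
move=> mf f01 mg g01.
have mR J' D : rectangles mu J' D -> measurable D.
  exact: rectangles_measurable.
have bf := arm_measurable_bm mu_meas mf f01.
have bg := arm_measurable_bm mu_meas mg g01.
have H E : rectangles mu (predC J) E ->
    ex (fun w => f w * \1_E w) = ex f * fine (P E).
  move=> rE; apply/eqP; rewrite -subr_eq0; apply/eqP.
  have bE : bounded_mfun (\1_E : T -> R) by exact: bm_indic (mR _ _ rE).
  rewrite [ex f * _]mulrC -exZ// -exB; [|exact: bmM|by apply: bmM => //; exact: bm_cst].
  transitivity (ex (fun w => (\1_E w - fine (P E)) * f w)).
    by congr ex; apply/funext => w; ring.
  apply: (ex_orthogonal_measurable (@rectangles_setI _ _ _ _ mu J)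
    (rectanglesT mu J) (mR J)) => //; first by apply: bmB => //; exact: bm_cst.
  move=> D rD; rewrite ex_centered_mul_indic//; last exact: mR rD.
  rewrite mulrC.
  rewrite -(prob_rectangleI rD rE) -ex_indic; last by apply: measurableI; [exact: mR rD|exact: mR rE].
  rewrite -[X in _ - X](_ : ex (fun w => \1_E w * \1_D w) = _) ?subrr//.
  by congr ex; apply/funext => w; rewrite indicI /= mulrC.
apply/eqP; rewrite -subr_eq0; apply/eqP.
rewrite -exZ// -exB; [|exact: bmM|by apply: bmM => //; exact: bm_cst].
transitivity (ex (fun w => (f w - ex f) * g w)).
  by congr ex; apply/funext => w; ring.
apply: (ex_orthogonal_measurable (@rectangles_setI _ _ _ _ mu (predC J))
  (rectanglesT mu _) (mR _)) => //; first by apply: bmB => //; exact: bm_cst.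
by move=> D rD; rewrite ex_centered_mul_indic ?H ?subrr//; exact: mR rD.
Qed.

End Independence.

(** * Posterior covariances *)

Section PosteriorCovariance.
Set Implicit Arguments.
Unset Strict Implicit.
Context (d : measure_display) (T : measurableType d) (R : realType) (K : nat).
Variables (P : probability T R) (mu : 'I_K -> T -> R).
Hypothesis mu_meas : forall i, measurable_fun setT (mu i).
Hypothesis mu_indep : forall B : 'I_K -> set R, (forall k, measurable (B k)) ->
  fine (P [set w | forall k, B k (mu k w)]) =
  \prod_(k < K) fine (P [set w | B k (mu k w)]).
Hypothesis mu01 : forall i w, 0 <= mu i w <= 1.
Local Notation ex := (ex P).
Local Notation arm_measurable := (arm_measurable mu).
Implicit Types (h : seq ('I_K * bool)) (f g : T -> R).

Definition likelihood h (w : T) : R :=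
  \prod_(y <- h) (if y.2 then mu y.1 w else 1 - mu y.1 w).

(** Unnormalised posterior expectation: dividing by [lex h (fun=> 1)] gives the posterior mean of
    [f] after the rewards in [h]. *)
Definition lex h f : R := ex (fun w => f w * likelihood h w).

Lemma mul_unit_interval (x y : R) : 0 <= x <= 1 -> 0 <= y <= 1 -> 0 <= x * y <= 1.
Proof.
by move=> /andP[x0 x1] /andP[y0 y1]; rewrite mulr_ge0//= mulr_ile1.
Qed.

Lemma likelihood01 h w : 0 <= likelihood h w <= 1.
Proof.
rewrite /likelihood; elim: h => [|y h IH]; first by rewrite big_nil ler01 lexx.
rewrite big_cons; apply: mul_unit_interval => //.
by have := mu01 y.1 w; case: ifP => _ //; lra.
Qed.

Lemma indic01 (D : set T) w : 0 <= (\1_D w : R) <= 1.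
Proof. by rewrite indicE; case: (_ \in _); rewrite ?ler01 ?lexx. Qed.

Lemma arm_measurable_likelihood (J : pred 'I_K) h :
  (forall y, y \in h -> J y.1) -> arm_measurable J (likelihood h).
Proof.
move=> Jh; apply: (@measurable_prod _ (g_sigma_algebraType (rectangles mu J))) => y yh.
case: y.2; first exact: arm_measurable_mu (Jh _ yh).
apply: (@measurable_funB _ (g_sigma_algebraType (rectangles mu J))).
  exact: measurable_cst.
exact: arm_measurable_mu (Jh _ yh).
Qed.

Lemma bm_likelihood h : bounded_mfun (likelihood h).
Proof.
apply: (@arm_measurable_bm _ _ _ _ mu mu_meas xpredT); last exact: likelihood01.
exact: arm_measurable_likelihood.
Qed.

Lemma bm_mu i : bounded_mfun (mu i).
Proof.
apply: (@arm_measurable_bm _ _ _ _ mu mu_meas xpredT); last exact: mu01.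
exact: arm_measurable_mu.
Qed.

Lemma likelihood_split a h w : likelihood h w =
  likelihood [seq y <- h | y.1 == a] w * likelihood [seq y <- h | y.1 != a] w.
Proof. by rewrite /likelihood !big_filter; exact: bigID. Qed.

(** The likelihood is a product of a function of [mu a] and a function of the other means, so the
    posterior keeps [mu a] independent of the other arms. The equation is this independence with
    denominators cleared. *)
Lemma lex_arm_indep a h f g :
  arm_measurable (pred1 a) f -> (forall w, 0 <= f w <= 1) ->
  arm_measurable (predC1 a) g -> (forall w, 0 <= g w <= 1) ->
  lex h (fun=> 1) * lex h (fun w => f w * g w) = lex h f * lex h g.
Proof.
move=> mf f01 mg g01.
set l1 := likelihood [seq y <- h | y.1 == a].
set l2 := likelihood [seq y <- h | y.1 != a].
have m1 : arm_measurable (pred1 a) l1.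
  by apply: arm_measurable_likelihood => y; rewrite mem_filter => /andP[].
have m2 : arm_measurable (predC1 a) l2.
  by apply: arm_measurable_likelihood => y; rewrite mem_filter => /andP[].
have H f' g' : arm_measurable (pred1 a) f' -> (forall w, 0 <= f' w <= 1) ->
    arm_measurable (predC1 a) g' -> (forall w, 0 <= g' w <= 1) ->
    lex h (fun w => f' w * g' w) =
    ex (fun w => f' w * l1 w) * ex (fun w => g' w * l2 w).
  move=> mf' f'01 mg' g'01.
  rewrite -(ex_arm_indep mu_meas mu_indep (J := pred1 a)).
  - by congr ex; apply/funext => w; rewrite (likelihood_split a) -/l1 -/l2; ring.
  - exact: (@measurable_funM _ (g_sigma_algebraType (rectangles mu (pred1 a)))).
  - by move=> w; apply: mul_unit_interval; last exact: likelihood01.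
  - exact: (@measurable_funM _ (g_sigma_algebraType (rectangles mu (predC1 a)))).
  - by move=> w; apply: mul_unit_interval; last exact: likelihood01.
have c1 J : arm_measurable J (fun=> 1) by exact: measurable_cst.
have c01 (w : T) : (0 : R) <= 1 <= (1 : R) by rewrite ler01 lexx.
have E1 : lex h (fun=> 1) = lex h (fun w => 1 * 1).
  by congr lex; apply/funext => w; rewrite mulr1.
have E2 : lex h f = lex h (fun w => f w * 1).
  by congr lex; apply/funext => w; rewrite mulr1.
have E3 : lex h g = lex h (fun w => 1 * g w).
  by congr lex; apply/funext => w; rewrite mul1r.
by rewrite E1 E2 E3 !H//; ring.
Qed.

(** The posterior covariance of [mu a] and [f], times the square of [lex h (fun=> 1)]. *)
Definition lcov h a f : R :=
  lex h (fun=> 1) * lex h (fun w => mu a w * f w) - lex h (mu a) * lex h f.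

Lemma lcovE h a f : bounded_mfun f -> lcov h a f =
  ex (fun w => (lex h (fun=> 1) * mu a w - lex h (mu a)) * (f w * likelihood h w)).
Proof.
move=> bf; rewrite /lcov.
have bL := bm_likelihood h; have ba := bm_mu a.
rewrite [lex h (fun w => mu a w * f w)]/lex [lex h f]/lex.
have bM : bounded_mfun (fun w => mu a w * f w * likelihood h w).
  by apply: bmM => //; exact: bmM.
have bfL : bounded_mfun (fun w => f w * likelihood h w) by exact: bmM.
rewrite -!exZ// -exB; [|by apply: bmM => //; exact: bm_cst..].
by congr ex; apply/funext => w; ring.
Qed.

Lemma lex1_ge0 h : 0 <= lex h (fun=> 1).
Proof. by apply: ex_ge0 => w; rewrite mul1r; case/andP: (likelihood01 h w). Qed.

Lemma lcov_indep h a f :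
  arm_measurable (predC1 a) f -> (forall w, 0 <= f w <= 1) -> lcov h a f = 0.
Proof.
move=> mf f01; rewrite /lcov (lex_arm_indep (a := a)) ?subrr//.
by apply: arm_measurable_mu => /=; rewrite eqxx.
Qed.

Lemma lcovB h a f g : bounded_mfun f -> bounded_mfun g ->
  lcov h a (fun w => f w - g w) = lcov h a f - lcov h a g.
Proof.
move=> bf bg; have bL := bm_likelihood h; have ba := bm_mu a.
have bA : bounded_mfun (fun w => lex h (fun=> 1) * mu a w - lex h (mu a)).
  by apply: bmB; [apply: bmM => //|]; exact: bm_cst.
rewrite !lcovE//; last exact: bmB.
rewrite -exB; [|by apply: bmM => //; exact: bmM..].
by congr ex; apply/funext => w; ring.
Qed.

(** Meant for indicators: an event is compared with one that does not involve [mu a], whose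
    covariance vanishes by [lcov_indep]. *)
Lemma lcov_le h a f g : bounded_mfun f -> bounded_mfun g ->
  (forall w, (lex h (fun=> 1) * mu a w - lex h (mu a)) * f w <=
             (lex h (fun=> 1) * mu a w - lex h (mu a)) * g w) ->
  lcov h a f <= lcov h a g.
Proof.
move=> bf bg fg; have bL := bm_likelihood h; have ba := bm_mu a.
have bA : bounded_mfun (fun w => lex h (fun=> 1) * mu a w - lex h (mu a)).
  by apply: bmB; [apply: bmM => //|]; exact: bm_cst.
rewrite !lcovE//; apply: ex_le; [by apply: bmM => //; exact: bmM..|].
move=> w; rewrite !mulrA; apply: ler_wpM2r => //.
by case/andP: (likelihood01 h w).
Qed.

(* For [p = lex h 1] and [m = lex h (mu a)], the weighted expectation of
   [p (mu a) - m] is zero, so [p * lcov h a (mu a)] is that of its square. *)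
Lemma lcov_self_ge0 h a : 0 < lex h (fun=> 1) -> 0 <= lcov h a (mu a).
Proof.
move=> p0; have bL := bm_likelihood h; have ba := bm_mu a.
pose p := lex h (fun=> 1); pose m := lex h (mu a).
have c1 : lcov h a (fun=> 1) = 0.
  by apply: lcov_indep; [exact: measurable_cst|move=> w; rewrite ler01 lexx].
rewrite lcovE// in c1; last exact: bm_cst.
rewrite -/p -/m in c1.
have bA : bounded_mfun (fun w => p * mu a w - m).
  by apply: bmB; [apply: bmM => //|]; exact: bm_cst.
rewrite -(pmulr_rge0 _ p0) lcovE// -/p -/m.
rewrite -[X in 0 <= X]subr0 -[X in _ - X](mulr0 m) -[X in m * X]c1.
rewrite -!exZ; [|by repeat (apply: bmM => //); exact: bm_cst..].
rewrite -exB; [|by repeat (apply: bmM => //); exact: bm_cst..].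
apply: ex_ge0 => w.
have -> : p * ((p * mu a w - m) * (mu a w * likelihood h w)) -
    m * ((p * mu a w - m) * (1 * likelihood h w)) =
    (p * mu a w - m) ^+ 2 * likelihood h w by ring.
by rewrite mulr_ge0 ?sqr_ge0//; case/andP: (likelihood01 h w).
Qed.

Lemma arm_measurable_set (J : pred 'I_K) (D : set T) :
  <<s rectangles mu J>> D -> measurable D.
Proof.
apply: smallest_sub; [exact: sigma_algebra_measurable|].
exact: rectangles_measurable.
Qed.

Lemma measurable_best i : measurable [set w | is_best mu w i].
Proof. by apply: (@arm_measurable_set xpredT); exact: arm_measurable_best. Qed.

Lemma arm_measurable_scale (J : pred 'I_K) c k : J k ->
  arm_measurable J (fun w => c * mu k w).
Proof.
move=> Jk; apply: (@measurable_funM _ (g_sigma_algebraType (rectangles mu J))).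
  exact: measurable_cst.
exact: arm_measurable_mu.
Qed.

(* Replacing the event that [i] is best by the event that all other arms lie
   below the posterior mean of [mu i] decreases [(mu i - mean) * 1_event]
   pointwise, and the latter event is independent of [mu i]. *)
Lemma lcov_best_own h i : 0 <= lcov h i \1_[set w | is_best mu w i].
Proof.
set p := lex h (fun=> 1); set m := lex h (mu i).
pose D : set T := [set w | forall k, k != i -> p * mu k w < m].
have mD : <<s rectangles mu (predC1 i)>> D.
  apply: (@arm_measurable_forall _ _ _ _ mu (predC1 i) (predC1 i)
    (fun k => [set w | p * mu k w < m])) => k ki.
  apply: arm_measurable_lt; last exact: measurable_cst.
  exact: arm_measurable_scale.
rewrite -(@lcov_indep h i \1_D); last 2 first.
- exact: arm_measurable_indic.
- exact: indic01.
have p0 := lex1_ge0 h; rewrite -/p in p0.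
apply: lcov_le; [exact: bm_indic (arm_measurable_set mD)|exact: bm_indic (measurable_best i)|].
move=> w; rewrite -/p -/m !indicE.
(* At or above the mean the factor is nonnegative and [D] forces [i] to be best; below it the factor
   is negative and [i] being best forces [D]. *)
have [mi|mi] := leP m (p * mu i w).
  apply: ler_wpM2l; first by rewrite subr_ge0.
  case: (boolP (w \in D)) => //= /set_mem wD.
  rewrite mem_set//=.
  have lt k : k != i -> mu k w < mu i w.
    move=> ki; have := lt_le_trans (wD k ki) mi.
    by rewrite ltNge => /negP h1; rewrite ltNge; apply/negP => h2; apply: h1; exact: ler_wpM2l.
  split=> k; first by have [->|/lt/ltW] := eqVneq k i.
  by move=> ki; apply: lt; apply: contraTneq ki => ->; rewrite ltnn.
apply: ler_wnM2l; first by rewrite subr_le0 ltW.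
case: (boolP (w \in [set w | is_best mu w i])) => //= /set_mem [le _].
rewrite mem_set//= => k _; apply: le_lt_trans mi; exact: ler_wpM2l.
Qed.

(** [F] says that [i] reaches the posterior mean of [mu a] and beats every arm other than [a]; it
    does not involve [mu a]. When [mu a] is above its mean, [i] being best implies [F]; when it is
    below, [F] implies that [i] is best. So passing to [F] can only raise the covariance, which for
    [F] is zero. *)
Lemma lcov_best_other h a i : a != i -> lcov h a \1_[set w | is_best mu w i] <= 0.
Proof.
move=> ai; set p := lex h (fun=> 1); set m := lex h (mu a).
pose F : set T := [set w | m <= p * mu i w] `&`
  ([set w | forall k, k != a -> mu k w <= mu i w] `&`
   [set w | forall k : 'I_K, (k != a) && (k < i)%N -> mu k w < mu i w]).
have ia : predC1 a i by rewrite /= eq_sym.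
have mF : <<s rectangles mu (predC1 a)>> F.
  apply: (@measurableI _ (g_sigma_algebraType (rectangles mu (predC1 a)))).
    apply: arm_measurable_le; first exact: measurable_cst.
    exact: arm_measurable_scale.
  apply: (@measurableI _ (g_sigma_algebraType (rectangles mu (predC1 a)))).
    apply: (@arm_measurable_forall _ _ _ _ mu (predC1 a) (predC1 a)
      (fun k => [set w | mu k w <= mu i w])) => k ka.
    by apply: arm_measurable_le; exact: arm_measurable_mu.
  apply: (@arm_measurable_forall _ _ _ _ mu (predC1 a)
    (fun k : 'I_K => (k != a) && (k < i)%N)
    (fun k => [set w | mu k w < mu i w])) => k /andP[ka _].
  by apply: arm_measurable_lt; exact: arm_measurable_mu.
rewrite -(@lcov_indep h a \1_F); last 2 first.
- exact: arm_measurable_indic.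
- exact: indic01.
have p0 := lex1_ge0 h; rewrite -/p in p0.
apply: lcov_le; [exact: bm_indic (measurable_best i)|exact: bm_indic (arm_measurable_set mF)|].
move=> w; rewrite -/p -/m !indicE.
have [mi|mi] := leP m (p * mu a w).
  apply: ler_wpM2l; first by rewrite subr_ge0.
  case: (boolP (w \in [set w | is_best mu w i])) => //= /set_mem [le lt].
  rewrite mem_set//; split; first by apply: le_trans mi _; exact: ler_wpM2l.
  by split => k /=; [move=> _; exact: le|case/andP=> _; exact: lt].
apply: ler_wnM2l; first by rewrite subr_le0 ltW.
case: (boolP (w \in F)) => //= /set_mem [/= mpi [le lt]].
(* Strictness matters: [i] then beats [a] whichever way ties between them are broken. *)
have lta : mu a w < mu i w.
  have := lt_le_trans mi mpi.
  by rewrite ltNge => /negP h1; rewrite ltNge; apply/negP => h2; apply: h1; exact: ler_wpM2l.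
rewrite mem_set//=; split=> k; first by have [->|/le] := eqVneq k a; first exact: ltW.
by move=> ki; have [->//|ka] := eqVneq k a; apply: lt; rewrite ka.
Qed.

Lemma lcov_best_diff_ge0 h a i j : 0 < lex h (fun=> 1) -> i != j ->
  0 <= lcov h a \1_[set w | is_best mu w i] * lcov h a (fun w => mu i w - mu j w).
Proof.
move=> p0 ij; rewrite lcovB; [|exact: bm_mu|exact: bm_mu].
have z k : k != a -> lcov h a (mu k) = 0.
  by move=> ka; apply: lcov_indep; [exact: arm_measurable_mu|exact: mu01].
have [ai|ai] := eqVneq a i.
  rewrite ai in z *; rewrite [lcov h i (mu j)]z 1?eq_sym// subr0.
  by rewrite mulr_ge0 ?lcov_best_own ?lcov_self_ge0.
have [aj|aj] := eqVneq a j.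
  rewrite aj in z ai *; rewrite [lcov h j (mu i)]z// sub0r mulrN -mulNr.
  by rewrite mulr_ge0 ?lcov_self_ge0// oppr_ge0 lcov_best_other.
by rewrite !z 1?eq_sym// subrr mulr0.
Qed.

End PosteriorCovariance.

(** * The law of the history *)

Section Histories.
Set Implicit Arguments.
Unset Strict Implicit.
Context (d : measure_display) (T : measurableType d) (R : realType) (K : nat).
Variables (P : probability T R) (mu : 'I_K -> T -> R).
Variables (X : 'I_K -> nat -> T -> bool) (A : nat -> T -> 'I_K).
Hypothesis mu_meas : forall i, measurable_fun setT (mu i).
Hypothesis mu01 : forall i w, 0 <= mu i w <= 1.
Hypothesis X_meas : forall i n, measurable [set w | X i n w].
Hypothesis A_meas : forall t i, measurable [set w | A t w = i].
Hypothesis X_bern : forall (B : 'I_K -> set R) (S : seq ('I_K * nat))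
    (x : 'I_K -> nat -> bool),
  (forall k, measurable (B k)) -> uniq S ->
  P (cylinder mu X B S x) =
  (\int[P]_(w in [set w | forall k, B k (mu k w)])
     (\prod_(p <- S) (if x p.1 p.2 then mu p.1 w else 1 - mu p.1 w))%:E)%E.
Hypothesis TS : forall (t : nat) (i : 'I_K) (h : seq ('I_K * bool))
    (B : 'I_K -> set R) (S : seq ('I_K * nat)) (x : 'I_K -> nat -> bool),
  (forall k, measurable (B k)) ->
  (P ([set w | A t w = i /\ history X A t w = h] `&` cylinder mu X B S x)
     * P [set w | history X A t w = h] =
   P [set w | is_best mu w i /\ history X A t w = h]
     * P ([set w | history X A t w = h] `&` cylinder mu X B S x))%E.
Local Notation ex := (ex P).
Local Notation lex := (lex P mu).
Local Notation pr D := (fine (P D)).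
Implicit Types (h : seq ('I_K * bool)) (f g : T -> R).

Definition pulls (a : 'I_K) h : nat := count (fun y => y.1 == a) h.

(* Histories [h] are listed with the latest round first, so that appending a
   round is [cons]; hence the [rev] in [history_event]. *)
Fixpoint slots h : seq ('I_K * nat) :=
  if h is y :: h' then (y.1, pulls y.1 h') :: slots h' else [::].

Fixpoint agrees (x : 'I_K -> nat -> bool) h : bool :=
  if h is y :: h' then (x y.1 (pulls y.1 h') == y.2) && agrees x h' else true.

(** A table of samples that produces the rewards of [h]; the value [true] at unrevealed samples is
    arbitrary. *)
Fixpoint outcome h : 'I_K -> nat -> bool :=
  if h is y :: h' then
    fun a n => if (a == y.1) && (n == pulls y.1 h') then y.2 else outcome h' a n
  else fun _ _ => true.

Definition history_event h : set T :=
  [set w | history X A (size h) w = rev h].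

Definition best_event (i : 'I_K) : set T := [set w | is_best mu w i].

(** Product along [h] of the posterior probabilities with which Thompson sampling recommends the
    arms of [h]; a null prefix gives 0 through x / 0 = 0. *)
Fixpoint policy_weight h : R :=
  if h is y :: h' then
    pr (best_event y.1 `&` history_event h') / pr (history_event h')
      * policy_weight h'
  else 1.

(** Samples are numbered from 0, so the next sample of an arm is always fresh; this yields distinct
    slots and keeps [outcome] from overwriting earlier rewards. *)
Lemma slots_pulls h p : p \in slots h -> (p.2 < pulls p.1 h)%N.
Proof.
elim: h => // y h IH; rewrite /= inE => /predU1P[->|/IH lt] /=.
  by rewrite /pulls /= eqxx.
by apply: leq_trans lt _; rewrite /pulls /= leq_addl.
Qed.

Lemma slots_uniq h : uniq (slots h).
Proof.
elim: h => //= y h ->; rewrite andbT; apply/negP => /slots_pulls /=.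
by rewrite ltnn.
Qed.

Lemma agreesP x h : agrees x h ->
  forall w, \prod_(p <- slots h) (if x p.1 p.2 then mu p.1 w else 1 - mu p.1 w) =
            likelihood mu h w.
Proof.
elim: h => [_ w|y h IH /= /andP[/eqP xy /IH E] w]; rewrite /likelihood.
  by rewrite !big_nil.
by rewrite !big_cons E /= xy.
Qed.

Lemma eq_agrees x x' h : (forall p, p \in slots h -> x p.1 p.2 = x' p.1 p.2) ->
  agrees x h = agrees x' h.
Proof.
elim: h => //= y h IH E; rewrite (E (y.1, pulls y.1 h)) ?mem_head// IH// => p ph.
by apply: E; rewrite inE ph orbT.
Qed.

Lemma agrees_outcome h : agrees (outcome h) h.
Proof.
elim: h => //= y h IH; rewrite !eqxx /=.
rewrite (@eq_agrees _ (outcome h))// => p /slots_pulls.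
by case: andP => //= -[/eqP -> /eqP ->]; rewrite ltnn.
Qed.

Lemma historyS t w : history X A t.+1 w =
  rcons (history X A t w) (A t w, reward X A t w).
Proof. by rewrite /history -addn1 iotaD map_cat cats1. Qed.

Lemma size_history t w : size (history X A t w) = t.
Proof. by rewrite size_map size_iota. Qed.

Lemma history_event_nil : history_event [::] = setT.
Proof. by apply/seteqP; split. Qed.

Lemma history_event_cons y h : history_event (y :: h) =
  [set w | A (size h) w = y.1 /\ history X A (size h) w = rev h] `&`
  [set w | X y.1 (pulls y.1 h) w = y.2].
Proof.
have npullsE w : history X A (size h) w = rev h ->
    npulls A (size h) w = pulls (A (size h) w) h.
  move=> E; rewrite /pulls -(count_rev _ h) -E /history count_map.
  exact: eq_count.
apply/seteqP; split => w; rewrite /history_event /= historyS rev_cons.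
  move/rcons_inj => [E <-] /=; split=> //.
  by rewrite /reward npullsE.
case=> -[Ay E] Xy; rewrite E; congr rcons.
by rewrite /reward npullsE// Ay Xy -surjective_pairing.
Qed.

Lemma measurable_history_event h : measurable (history_event h).
Proof.
elim: h => [|y h IH]; first by rewrite history_event_nil.
rewrite history_event_cons; apply: measurableI.
  exact: (measurableI _ _ (A_meas (size h) y.1) IH).
case: (y.2); first exact: X_meas.
have -> : [set w | X y.1 (pulls y.1 h) w = false] =
    ~` [set w | X y.1 (pulls y.1 h) w].
  by apply/seteqP; split => w /=; case: (X _ _ w).
exact: measurableC.
Qed.

Lemma measurable_cylinder B S x : (forall k, measurable (B k)) ->
  measurable (cylinder mu X B S x).
Proof.
move=> mB; suff mS : measurable
    [set w | forall p : 'I_K * nat, p \in S -> X p.1 p.2 w = x p.1 p.2].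
  exact: (measurableI _ _ (measurable_rectangle mu_meas mB) mS).
elim: S => [|p S IH].
  have -> : [set w | forall p : 'I_K * nat, p \in [::] -> X p.1 p.2 w = x p.1 p.2] = setT.
    by apply/seteqP; split.
  exact: measurableT.
have -> : [set w | forall q : 'I_K * nat, q \in p :: S -> X q.1 q.2 w = x q.1 q.2] =
    [set w | X p.1 p.2 w = x p.1 p.2] `&`
    [set w | forall q : 'I_K * nat, q \in S -> X q.1 q.2 w = x q.1 q.2].
  apply/seteqP; split => w /=.
    by move=> H; split => [|q qS]; apply: H; rewrite inE ?eqxx ?qS ?orbT.
  by move=> [H1 H2] q; rewrite inE => /predU1P[->|/H2].
apply: measurableI => //; case: (x p.1 p.2); first exact: X_meas.
have -> : [set w | X p.1 p.2 w = false] = ~` [set w | X p.1 p.2 w].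
  by apply/seteqP; split => w /=; case: (X _ _ w).
exact: measurableC.
Qed.

Lemma prM (D E F G : set T) : measurable D -> measurable E -> measurable F ->
  measurable G -> (P D * P E = P F * P G)%E -> pr D * pr E = pr F * pr G.
Proof.
move=> mD mE mF mG H.
by rewrite -!fineM ?H//; exact: fin_num_measure.
Qed.

Lemma pr_eq0 (D E : set T) : measurable D -> measurable E -> D `<=` E ->
  pr E = 0 -> pr D = 0.
Proof.
move=> mD mE DE E0; apply/eqP; rewrite eq_le fine_ge0// andbT -E0.
by apply: fine_le; rewrite ?fin_num_measure// le_measure ?inE.
Qed.

(* The history probability factors into the recommendation probabilities, which
   do not depend on the means, and the likelihood of the revealed samples. *)
Lemma pr_history_cylinder h B S x : (forall k, measurable (B k)) -> agrees x h ->
  pr (history_event h `&` cylinder mu X B S x) =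
  policy_weight h * pr (cylinder mu X B (slots h ++ S) x).
Proof.
(* [S] is generalised because the sample revealed in the last round is moved into it: [TS] then
   removes the last recommendation, and the induction hypothesis applies to the shorter history with
   one more prescribed sample. *)
move=> mB; elim: h S => [|y h IH] S; first by rewrite history_event_nil setTI mul1r.
move=> /= /andP[/eqP xy xh].
have mC S' := measurable_cylinder S' x mB.
have mH := measurable_history_event h.
have mb : measurable (best_event y.1) by exact: measurable_best.
set s := (y.1, pulls y.1 h).
have -> : history_event (y :: h) `&` cylinder mu X B S x =
    [set w | A (size h) w = y.1 /\ history X A (size h) w = rev h] `&`
    cylinder mu X B (s :: S) x.
  rewrite history_event_cons; apply/seteqP; split => w /=.
    move=> [[H Xy] [Bw Sw]]; split => //; split => // p.
    by rewrite inE => /predU1P[->|/Sw//]; rewrite /= xy.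
  move=> [H [Bw Sw]]; split; first by split => //; rewrite (Sw s) ?mem_head.
  by split => // p pS; apply: Sw; rewrite inE pS orbT.
have mAH : measurable [set w | A (size h) w = y.1 /\ history X A (size h) w = rev h].
  exact: (measurableI _ _ (A_meas (size h) y.1) mH).
have [H0|H0] := eqVneq (pr (history_event h)) 0.
  rewrite H0 invr0 mulr0 !mul0r; apply: pr_eq0 H0 => //; first exact: measurableI.
  by move=> w [[]].
have := @TS (size h) y.1 (rev h) B (s :: S) x mB.
move=> /(prM (measurableI _ _ mAH (mC _)) mH (measurableI _ _ mb mH)
  (measurableI _ _ mH (mC _))).
rewrite -/(history_event h) IH// => E.
apply: (mulIf H0); rewrite E -/(best_event y.1).
have -> : cylinder mu X B (slots h ++ s :: S) x =
    cylinder mu X B (s :: slots h ++ S) x.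
  apply/seteqP; split => w [Bw Sw]; split => // p pS; apply: Sw;
    by move: pS; rewrite !(inE, mem_cat) orbCA.
by field.
Qed.

Lemma pr_history_rectangle h B : (forall k, measurable (B k)) ->
  pr (history_event h `&` rectangle mu B) =
  policy_weight h * lex h \1_(rectangle mu B).
Proof.
move=> mB.
have cyl0 x : cylinder mu X B [::] x = rectangle mu B.
  by apply/seteqP; split => w /=; [case|].
rewrite -(cyl0 (outcome h)) pr_history_cylinder// ?agrees_outcome// cats0.
rewrite X_bern ?slots_uniq//; congr (_ * _).
rewrite cyl0.
have -> : lex h \1_(rectangle mu B) =
    ex (fun w => likelihood mu h w * \1_(rectangle mu B) w).
  by congr ex; apply/funext => w; rewrite mulrC.
rewrite ex_mul_indic /Rintegral; congr fine; apply: eq_integral => w _.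
by rewrite (agreesP (agrees_outcome h)).
Qed.

(** On rectangles this is [pr_history_rectangle]; the difference of the history indicator and the
    weighted likelihood is thus orthogonal to all rectangles, hence to every function of the
    means. *)
Lemma ex_history h g : arm_measurable mu xpredT g -> (forall w, 0 <= g w <= 1) ->
  ex (fun w => \1_(history_event h) w * g w) = policy_weight h * lex h g.
Proof.
move=> mg g01; apply/eqP; rewrite -subr_eq0; apply/eqP.
have bH : bounded_mfun (\1_(history_event h) : T -> R).
  exact: bm_indic (measurable_history_event h).
have bL := bm_likelihood mu_meas mu01 h.
have bg := arm_measurable_bm mu_meas mg g01.
have bcL : bounded_mfun (fun w => policy_weight h * likelihood mu h w).
  by apply: bmM => //; exact: bm_cst.
have E f : bounded_mfun f ->
    ex (fun w => \1_(history_event h) w * f w) - policy_weight h * lex h f =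
    ex (fun w => (\1_(history_event h) w - policy_weight h * likelihood mu h w) * f w).
  move=> bf; rewrite -exZ; last exact: bmM.
  rewrite -exB; [|exact: bmM|by apply: bmM; [exact: bm_cst|exact: bmM]].
  by congr ex; apply/funext => w; ring.
rewrite E//; apply: (ex_orthogonal_measurable (@rectangles_setI _ _ _ _ mu xpredT)
    (rectanglesT mu _) (rectangles_measurable mu_meas (J := xpredT))) => //.
  exact: bmB.
move=> D rD; have mD : measurable D by exact: rectangles_measurable rD.
rewrite -E; last exact: bm_indic.
case: rD => B [mB _] DB; rewrite DB -pr_history_rectangle// -DB -ex_indic.
  by rewrite indicI subrr.
by apply: measurableI => //; exact: measurable_history_event.
Qed.

(** Conditional independence of the recommendation and the means given the history, with
    denominators cleared: [TS] with no prescribed samples gives it on rectangles. *)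
Lemma ex_recommend h i g : arm_measurable mu xpredT g -> (forall w, 0 <= g w <= 1) ->
  ex (fun w => \1_([set w | A (size h) w = i] `&` history_event h) w * g w)
    * pr (history_event h) =
  pr (best_event i `&` history_event h)
    * ex (fun w => \1_(history_event h) w * g w).
Proof.
move=> mg g01; apply/eqP; rewrite -subr_eq0; apply/eqP.
have mH := measurable_history_event h.
have mb : measurable (best_event i) by exact: measurable_best.
have mAH := measurableI _ _ (A_meas (size h) i) mH.
set AH := _ `&` history_event h in mAH *; set H := history_event h in mH *.
have bH : bounded_mfun (\1_H : T -> R) by exact: bm_indic.
have bAH : bounded_mfun (\1_AH : T -> R) by exact: bm_indic.
have bg := arm_measurable_bm mu_meas mg g01.
set c := pr H; set c' := pr (best_event i `&` H).
have bc f e : bounded_mfun f -> bounded_mfun (fun w => e * f w).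
  by move=> bf; apply: bmM => //; exact: bm_cst.
have E f : bounded_mfun f ->
    ex (fun w => \1_AH w * f w) * c - c' * ex (fun w => \1_H w * f w) =
    ex (fun w => (c * \1_AH w - c' * \1_H w) * f w).
  move=> bf; rewrite [_ * c]mulrC -!exZ; [|exact: bmM..].
  rewrite -exB; [|by apply: bc; exact: bmM..].
  by congr ex; apply/funext => w; ring.
rewrite E//; apply: (ex_orthogonal_measurable (@rectangles_setI _ _ _ _ mu xpredT)
    (rectanglesT mu _) (rectangles_measurable mu_meas (J := xpredT))) => //.
  by apply: bmB; exact: bc.
move=> D rD; have mD : measurable D by exact: rectangles_measurable rD.
rewrite -E; last exact: bm_indic.
case: rD => B [mB _] DB.
have ID (F : set T) : measurable F -> ex (fun w => \1_F w * \1_D w) = pr (F `&` D).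
  by move=> mF; rewrite -ex_indic ?indicI//; exact: measurableI.
rewrite !ID//; apply/eqP; rewrite subr_eq0; apply/eqP.
have cyl0 x : cylinder mu X B [::] x = D.
  by rewrite DB; apply/seteqP; split => w /=; [case|].
have := @TS (size h) i (rev h) B [::] (fun _ _ => true) mB; rewrite cyl0.
by apply: prM => //; exact: measurableI.
Qed.

End Histories.

(** * Monotonicity in time *)

(* The difference of the two sides is
   [(q1 * p0 - q0 * p1) * (m1 * p0 - m0 * p1) / (p0 * p1 * (p1 + p0))]; the
   junk value [x / 0 = 0] makes the statement hold when [p1] or [p0] is zero. *)
Lemma split_product_ratio (R : realFieldType) (p1 p0 q1 q0 m1 m0 : R) :
  0 < p1 + p0 -> 0 <= q1 <= p1 -> 0 <= q0 <= p0 -> `|m1| <= p1 -> `|m0| <= p0 ->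
  0 <= ((p1 + p0) * q1 - p1 * (q1 + q0)) * ((p1 + p0) * m1 - p1 * (m1 + m0)) ->
  (q1 + q0) * (m1 + m0) / (p1 + p0) <= q1 * m1 / p1 + q0 * m0 / p0.
Proof.
move=> p_gt0 /andP[q1_ge0 q1p] /andP[q0_ge0 q0p] m1p m0p cov.
have [p1z|p1nz] := eqVneq p1 0.
  have m1z : m1 = 0 by apply/eqP; rewrite -normr_le0 -p1z.
  have q1z : q1 = 0 by apply/eqP; rewrite eq_le q1_ge0 -p1z q1p.
  by rewrite m1z q1z p1z !add0r invr0 mulr0 add0r.
have [p0z|p0nz] := eqVneq p0 0.
  have m0z : m0 = 0 by apply/eqP; rewrite -normr_le0 -p0z.
  have q0z : q0 = 0 by apply/eqP; rewrite eq_le q0_ge0 -p0z q0p.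
  by rewrite m0z q0z p0z !addr0 invr0 mulr0 addr0.
have p1_gt0 : 0 < p1 by rewrite lt0r p1nz (le_trans q1_ge0).
have p0_gt0 : 0 < p0 by rewrite lt0r p0nz (le_trans q0_ge0).
rewrite -subr_ge0.
have -> : q1 * m1 / p1 + q0 * m0 / p0 - (q1 + q0) * (m1 + m0) / (p1 + p0) =
    ((p1 + p0) * q1 - p1 * (q1 + q0)) * ((p1 + p0) * m1 - p1 * (m1 + m0))
      / (p1 * p0 * (p1 + p0)).
  by field; rewrite p1nz p0nz gt_eqF.
by rewrite divr_ge0// !mulr_ge0 ?ltW.
Qed.

(** * Expected advantage of the recommended arm *)

Section ValueOfRecommending.
Set Implicit Arguments.
Unset Strict Implicit.
Context (d : measure_display) (T : measurableType d) (R : realType) (K : nat).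
Hypothesis K_gt0 : (0 < K)%N.
Variables (P : probability T R) (mu : 'I_K -> T -> R).
Variables (X : 'I_K -> nat -> T -> bool) (A : nat -> T -> 'I_K).
Hypothesis mu_meas : forall i, measurable_fun setT (mu i).
Hypothesis mu01 : forall i w, 0 <= mu i w <= 1.
Hypothesis mu_indep : forall B : 'I_K -> set R, (forall k, measurable (B k)) ->
  fine (P [set w | forall k, B k (mu k w)]) =
  \prod_(k < K) fine (P [set w | B k (mu k w)]).
Hypothesis X_meas : forall i n, measurable [set w | X i n w].
Hypothesis A_meas : forall t i, measurable [set w | A t w = i].
Hypothesis X_bern : forall (B : 'I_K -> set R) (S : seq ('I_K * nat))
    (x : 'I_K -> nat -> bool),
  (forall k, measurable (B k)) -> uniq S ->
  P (cylinder mu X B S x) =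
  (\int[P]_(w in [set w | forall k, B k (mu k w)])
     (\prod_(p <- S) (if x p.1 p.2 then mu p.1 w else 1 - mu p.1 w))%:E)%E.
Hypothesis TS : forall (t : nat) (i : 'I_K) (h : seq ('I_K * bool))
    (B : 'I_K -> set R) (S : seq ('I_K * nat)) (x : 'I_K -> nat -> bool),
  (forall k, measurable (B k)) ->
  (P ([set w | A t w = i /\ history X A t w = h] `&` cylinder mu X B S x)
     * P [set w | history X A t w = h] =
   P [set w | is_best mu w i /\ history X A t w = h]
     * P ([set w | history X A t w = h] `&` cylinder mu X B S x))%E.
Local Notation ex := (ex P).
Local Notation lex := (lex P mu).
Local Notation pr D := (fine (P D)).
Local Notation best i := (best_event mu i).
Local Notation Hev h := (history_event X A h).
Local Notation weight h := (policy_weight P mu X A h).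
Implicit Types (h : seq ('I_K * bool)) (f g : T -> R).

Lemma exists_best w : exists i, is_best mu w i.
Proof.
pose M i := [forall j, mu j w <= mu i w].
have [i0 Mi0] : exists i, M i.
  case: (arg_maxP (fun i => mu i w) (erefl : xpredT (Ordinal K_gt0))) => i _ hi.
  by exists i; apply/forallP => j; exact: hi.
case: (arg_minnP (fun i : 'I_K => val i) Mi0) => i /forallP Mi mini.
exists i; split => // j ji; rewrite lt_neqAle Mi andbT; apply/eqP => E.
have : M j by apply/forallP => k; rewrite E.
by move/mini; rewrite leqNgt ji.
Qed.

Lemma is_best_inj w i j : is_best mu w i -> is_best mu w j -> i = j.
Proof.
move=> [lei lti] [lej ltj]; apply/val_inj.
case: (ltngtP (val i) (val j)) => //.
  by move=> /ltj; rewrite ltNge lei.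
by move=> /lti; rewrite ltNge lej.
Qed.

Lemma sum_best w : \sum_(i < K) \1_(best i) w = 1 :> R.
Proof.
have [i hi] := exists_best w; rewrite (bigD1 i)//= big1 => [|j ji].
  by rewrite addr0 indicE mem_set.
rewrite indicE memNset// => hj; case/eqP: ji; exact: is_best_inj hj hi.
Qed.

Lemma bm_best i : bounded_mfun (\1_(best i) : T -> R).
Proof. exact: bm_indic (measurable_best mu_meas i). Qed.

Lemma sum_lex_best h : \sum_(i < K) lex h \1_(best i) = lex h (fun=> 1).
Proof.
have bL := bm_likelihood mu_meas mu01 h.
rewrite -ex_sum; last by move=> i; apply: bmM => //; exact: bm_best.
by congr ex; apply/funext => w; rewrite -mulr_suml sum_best.
Qed.

Lemma lex_cons a b h f : bounded_mfun f ->
  lex ((a, b) :: h) f =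
  if b then lex h (fun w => mu a w * f w) else lex h f - lex h (fun w => mu a w * f w).
Proof.
move=> bf; have bL := bm_likelihood mu_meas mu01 h.
have ba := bm_mu mu_meas mu01 a.
case: b.
  by congr ex; apply/funext => w; rewrite /likelihood big_cons /=; ring.
rewrite -exB; [|exact: bmM|by apply: bmM => //; exact: bmM].
by congr ex; apply/funext => w; rewrite /likelihood big_cons /=; ring.
Qed.

Lemma lex_norm_le h f : bounded_mfun f -> (forall w, -1 <= f w <= 1) ->
  `|lex h f| <= lex h (fun=> 1).
Proof.
move=> bf f1; have bL := bm_likelihood mu_meas mu01 h.
have L0 w : 0 <= likelihood mu h w by case/andP: (likelihood01 mu01 h w).
have b1 : bounded_mfun (fun w => 1 * likelihood mu h w).
  by apply: bmM => //; exact: bm_cst.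
rewrite ler_norml; apply/andP; split.
  rewrite -mulN1r -exZ//; apply: ex_le; [by apply: bmM => //; exact: bm_cst|exact: bmM|].
  by move=> w; rewrite mul1r; apply: ler_wpM2r => //; case/andP: (f1 w).
apply: ex_le => //; first exact: bmM.
by move=> w; apply: ler_wpM2r => //; case/andP: (f1 w).
Qed.

Lemma lex_ge0 h f : (forall w, 0 <= f w) -> 0 <= lex h f.
Proof.
by move=> f0; apply: ex_ge0 => w; rewrite mulr_ge0//; case/andP: (likelihood01 mu01 h w).
Qed.

Lemma policy_weight_ge0 h : 0 <= weight h.
Proof.
elim: h => [|y h IH] /=; first exact: ler01.
by rewrite mulr_ge0// divr_ge0// fine_ge0.
Qed.

Lemma pr_history h : pr (Hev h) = weight h * lex h (fun=> 1).
Proof.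
rewrite -(ex_history mu_meas mu01 X_meas A_meas X_bern TS); last 2 first.
- exact: measurable_cst.
- by move=> w; rewrite ler01 lexx.
rewrite -ex_indic; last exact: measurable_history_event.
by congr ex; apply/funext => w; rewrite mulr1.
Qed.

Lemma pr_best_history i h : pr (best i `&` Hev h) = weight h * lex h \1_(best i).
Proof.
rewrite -(ex_history mu_meas mu01 X_meas A_meas X_bern TS); last 2 first.
- by apply: arm_measurable_indic; exact: arm_measurable_best.
- exact: indic01.
rewrite -ex_indic; last first.
  by apply: measurableI; [exact: measurable_best|exact: measurable_history_event].
by rewrite setIC indicI.
Qed.

(* [E[(mu i - mu j) 1{A_t = i, F_t = h}]], with [t = size h]. *)
Definition value i j h : R :=
  weight h * (lex h \1_(best i) * lex h (fun w => mu i w - mu j w)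
              / lex h (fun=> 1)).

Lemma bm_mu_diff i j : bounded_mfun (fun w => mu i w - mu j w).
Proof. by apply: bmB; exact: bm_mu. Qed.

Lemma value_eq0 i j h : weight h * lex h (fun=> 1) = 0 -> value i j h = 0.
Proof.
by rewrite /value => /eqP; rewrite mulf_eq0 => /orP[] /eqP ->; rewrite ?mul0r// invr0 !mulr0.
Qed.

Lemma ex_diff_recommend i j h :
  ex (fun w => \1_([set w | A (size h) w = i] `&` Hev h) w * (mu i w - mu j w)) =
  value i j h.
Proof.
have mH := measurable_history_event X_meas A_meas h.
have mAH := measurableI _ _ (A_meas (size h) i) mH.
set AH := _ `&` Hev h in mAH *.
have bAH : bounded_mfun (\1_AH : T -> R) by exact: bm_indic.
have bm k := bm_mu mu_meas mu01 k.
have bL := bm_likelihood mu_meas mu01 h.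
have -> : ex (fun w => \1_AH w * (mu i w - mu j w)) =
    ex (fun w => \1_AH w * mu i w) - ex (fun w => \1_AH w * mu j w).
  rewrite -exB; [|exact: bmM..].
  by congr ex; apply/funext => w; ring.
(* [ex_recommend] carries the factor [pr (Hev h)] and says nothing when it vanishes; both sides are
   then zero. *)
have [H0|H0] := eqVneq (pr (Hev h)) 0.
  rewrite value_eq0 -?pr_history//.
  have AH0 : pr AH = 0 by apply: pr_eq0 H0 => // w [].
  suff Z k : ex (fun w => \1_AH w * mu k w) = 0 by rewrite !Z subrr.
  apply/eqP; rewrite eq_le; apply/andP; split.
    rewrite -AH0 -ex_indic//; apply: ex_le => //; first exact: bmM.
    by move=> w; case/andP: (indic01 R AH w) => ? _; rewrite ler_piMr//; case/andP: (mu01 k w).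
  by apply: ex_ge0 => w; rewrite mulr_ge0//; case/andP: (mu01 k w).
have E k : ex (fun w => \1_AH w * mu k w) =
    weight h * lex h \1_(best i) * lex h (mu k) / lex h (fun=> 1).
  apply: (mulIf H0).
  have mk : arm_measurable mu xpredT (mu k) by exact: arm_measurable_mu.
  rewrite (ex_recommend mu_meas X_meas A_meas TS h i mk (mu01 k)).
  rewrite (ex_history mu_meas mu01 X_meas A_meas X_bern TS _ mk (mu01 k)).
  rewrite pr_history pr_best_history.
  move: H0; rewrite pr_history mulf_eq0 negb_or => /andP[_ p0].
  by field.
rewrite !E /value.
have -> : lex h (fun w => mu i w - mu j w) = lex h (mu i) - lex h (mu j).
  rewrite -exB; [|exact: bmM..].
  by congr ex; apply/funext => w; ring.
by ring.
Qed.

(* The posterior probability that [i] is best and the posterior mean of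
   [mu i - mu j] are martingales whose increments are positively correlated,
   whichever arm is observed. *)
Lemma value_le_sum i j h : i != j -> value i j h <= \sum_y value i j (y :: h).
Proof.
move=> ij.
have [H0|H0] := eqVneq (weight h * lex h (fun=> 1)) 0.
  rewrite value_eq0// big1// => y _.
  rewrite /value /= pr_best_history pr_history H0 invr0 mulr0 !mul0r.
  by [].
have := H0; rewrite mulf_eq0 negb_or => /andP[c0 p0].
have c_gt0 : 0 < weight h by rewrite lt0r c0 policy_weight_ge0.
have p_gt0 : 0 < lex h (fun=> 1).
  by rewrite lt0r p0 lex_ge0// => w; exact: ler01.
have -> : \sum_y value i j (y :: h) = \sum_a \sum_b value i j ((a, b) :: h).
  by rewrite pair_bigA; apply: eq_bigr => -[].
(* The old value is spread over the next arm [a] with its recommendation probabilities, so that the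
   inequality can be proved separately for each [a]. *)
have -> : value i j h = \sum_(a < K) lex h \1_(best a) / lex h (fun=> 1) * value i j h.
  by rewrite -mulr_suml -mulr_suml sum_lex_best divff// mul1r.
apply: ler_sum => a _; rewrite big_bool /value /=.
rewrite pr_best_history pr_history.
set c := weight h in c0 c_gt0 *; set p := lex h (fun=> 1) in p0 p_gt0 *.
have -> : c * lex h \1_(best a) / (c * p) = lex h \1_(best a) / p.
  by field; rewrite c0 p0.
rewrite -!mulrA -!mulrDr; apply: ler_wpM2l; first exact: lex_ge0.
apply: ler_wpM2l; first by rewrite invr_ge0 ltW.
apply: ler_wpM2l; first exact: ltW.
rewrite !mulrA.
have bq := bm_best i; have bm := bm_mu_diff i j.
have b1 : bounded_mfun (fun _ : T => 1 : R) by exact: bm_cst.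
have q01 (w : T) : 0 <= (\1_(best i) w : R) <= 1 by exact: indic01.
have q1 (w : T) : -1 <= (\1_(best i) w : R) <= 1 by have := q01 w; lra.
have m1 (w : T) : -1 <= mu i w - mu j w <= 1.
  by have := mu01 i w; have := mu01 j w; lra.
have split f : bounded_mfun f -> lex h f = lex ((a, true) :: h) f + lex ((a, false) :: h) f.
  by move=> bf; rewrite !lex_cons// addrC subrK.
(* Mass, event and mean difference are each split by the reward of [a], giving the variables of
   [split_product_ratio]; its sign condition becomes the product of the two [lcov] terms. *)
rewrite /p (split _ b1) (split _ bq) (split _ bm).
have lq b : 0 <= lex ((a, b) :: h) \1_(best i) <= lex ((a, b) :: h) (fun=> 1).
  rewrite lex_ge0 /=; last by move=> w; case/andP: (q01 w).
  exact: le_trans (ler_norm _) (lex_norm_le _ bq q1).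
apply: split_product_ratio => //; rewrite -?split//; try exact: lex_norm_le.
have := lcov_best_diff_ge0 mu_meas mu_indep mu01 a p_gt0 ij.
rewrite /lcov !lex_cons//.
have -> : lex h (fun w => mu a w * 1) = lex h (mu a).
  by congr lex; apply/funext => w; rewrite mulr1.
by [].
Qed.

(** * Summation over all histories of a given length *)

Fixpoint histories (t : nat) : seq (seq ('I_K * bool)) :=
  if t is s.+1 then
    [seq y :: h | h <- histories s, y <- index_enum ('I_K * bool)%type]
  else [:: [::]].

Lemma size_histories t h : h \in histories t -> size h = t.
Proof.
elim: t h => [|t IH] h /=; first by rewrite inE => /eqP ->.
by case/allpairsP => -[h' y] /= [/IH <- _ ->].
Qed.

Lemma big_histories t (F : seq ('I_K * bool) -> R) :
  \sum_(h <- histories t.+1) F h = \sum_(h <- histories t) \sum_y F (y :: h).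
Proof. by rewrite /= big_allpairs_dep. Qed.

Lemma sum_history_event t w : \sum_(h <- histories t) \1_(Hev h) w = 1 :> R.
Proof.
elim: t => [|t IH]; first by rewrite big_seq1 history_event_nil indicT.
rewrite big_histories -[RHS]IH big_seq [RHS]big_seq; apply: eq_bigr => h ht.
pose y0 := (A (size h) w, reward X A (size h) w).
have E y : \1_(Hev (y :: h)) w = (y0 == y)%:R * \1_(Hev h) w :> R.
  rewrite !indicE -natrM mulnb; congr (_%:R); congr nat_of_bool.
  apply/idP/idP => [/set_mem|/andP[/eqP <- /set_mem] H]; last first.
    by apply/mem_set; rewrite /history_event /= historyS rev_cons H.
  rewrite /history_event /= historyS rev_cons => /rcons_inj[H Hy].
  by rewrite /y0 Hy eqxx /=; apply/mem_set.
under eq_bigr do rewrite E.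
rewrite -mulr_suml (bigD1 y0)//= eqxx big1 ?addr0 ?mul1r// => y.
by rewrite eq_sym => /negbTE ->.
Qed.

Lemma ex_diff_arm i j t :
  ex (fun w => (mu i w - mu j w) * \1_[set w | A t w = i] w) =
  \sum_(h <- histories t) value i j h.
Proof.
have bA : bounded_mfun (\1_[set w | A t w = i] : T -> R) by exact: bm_indic.
have bm := bm_mu_diff i j.
have bH h : bounded_mfun (\1_(Hev h) : T -> R).
  exact: bm_indic (measurable_history_event X_meas A_meas h).
transitivity (ex (fun w => \sum_(h <- histories t)
    (mu i w - mu j w) * \1_[set w | A t w = i] w * \1_(Hev h) w)).
  by congr ex; apply/funext => w; rewrite -mulr_sumr sum_history_event mulr1.
rewrite ex_sum; last by move=> h; apply: bmM => //; exact: bmM.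
rewrite big_seq [RHS]big_seq; apply: eq_bigr => h /size_histories ht.
rewrite -ex_diff_recommend ht; congr ex; apply/funext => w.
by rewrite indicI /=; ring.
Qed.

Lemma ex_diff_recommended_ge0 :
  (forall i j, ex (mu i) = ex (mu j)) ->
  forall t i j, 0 <= ex (fun w => (mu i w - mu j w) * \1_[set w | A t w = i] w).
Proof.
move=> eqm t i j; have [->|ij] := eqVneq i j.
  by apply: ex_ge0 => w; rewrite subrr mul0r.
rewrite ex_diff_arm; elim: t => [|t IH].
  (* Only here do the equal prior means enter: under the prior, the mean of [mu i - mu j] is
     zero. *)
  rewrite big_seq1 /value.
  have -> : lex [::] (fun w => mu i w - mu j w) = ex (mu i) - ex (mu j).
    rewrite -exB; [|exact: bm_mu..].
    by congr ex; apply/funext => w; rewrite /likelihood big_nil mulr1.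
  by rewrite (eqm i j) subrr mulr0 mul0r mulr0.
apply: le_trans IH _; rewrite big_histories; apply: ler_sum => h _.
exact: value_le_sum.
Qed.

End ValueOfRecommending.

(** * Reduction to means in [0, 1] everywhere *)

Section Clipping.
Set Implicit Arguments.
Unset Strict Implicit.
Context (d : measure_display) (T : measurableType d) (R : realType).
Variable P : probability T R.

Definition clip (x : R) : R := Num.min (Num.max x 0) 1.

Lemma clip01 x : 0 <= clip x <= 1.
Proof. by rewrite /clip le_min le_max ge_min !lexx ler01 !orbT. Qed.

Lemma clip_id x : 0 <= x <= 1 -> clip x = x.
Proof. by case/andP=> x0 x1; rewrite /clip max_l// min_l. Qed.

Lemma measurable_clip (f : T -> R) :
  measurable_fun setT f -> measurable_fun setT (fun w => clip (f w)).
Proof.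
move=> mf; apply: measurable_minr; last exact: measurable_cst.
by apply: measurable_maxr => //; exact: measurable_cst.
Qed.

Lemma ae_of_probability1 (D : set T) : measurable D -> P D = 1%E ->
  {ae P, forall w, D w}.
Proof.
move=> mD D1; exists (~` D); split => //; first exact: measurableC.
by rewrite probability_setC// D1 subee.
Qed.

Lemma probability_ae_eq (D E : set T) : measurable D -> measurable E ->
  {ae P, forall w, D w <-> E w} -> P D = P E.
Proof.
move=> mD mE DE.
suff H (B C : set T) : measurable B -> measurable C ->
    {ae P, forall w, B w -> C w} -> P (B `\` C) = 0%E.
  have split B C : measurable B -> measurable C ->
    P B = (P (B `\` C) + P (B `&` C))%E by exact: measureDI.
  rewrite (split D E)// (split E D)// (setIC E).
  by rewrite !H//; apply: filterS DE => w [].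
move=> mB mC [N [mN N0 BCN]].
apply/eqP; rewrite eq_le measure_ge0 andbT -N0.
apply: le_measure; rewrite ?inE//; first exact: measurableD.
by move=> w [Bw nC]; apply: BCN => /= /(_ Bw).
Qed.

Lemma integral_ae_eq_set (D E : set T) (f g : T -> R) :
  measurable D -> measurable E -> measurable_fun setT f -> measurable_fun setT g ->
  {ae P, forall w, (D w <-> E w) /\ f w = g w} ->
  (\int[P]_(w in D) (f w)%:E = \int[P]_(w in E) (g w)%:E)%E.
Proof.
move=> mD mE mf mg fg; rewrite integral_mkcond [RHS]integral_mkcond.
have mpatch (C : set T) (u : T -> R) : measurable C -> measurable_fun setT u ->
    measurable_fun setT ((fun w => (u w)%:E) \_ C).
  move=> mC /(measurable_EFinP setT u) mu.
  by apply/(measurable_restrictT _ mC); exact: measurable_funTS mu.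
apply: ae_eq_integral => //; [exact: mpatch|exact: mpatch|].
apply: filterS fg => w [DE fgw] _; rewrite /patch fgw.
by have -> : (w \in D) = (w \in E) by apply/idP/idP => /set_mem /DE /mem_set.
Qed.

End Clipping.

Theorem theorem3p5 (R : realType) (K : nat) (hK : (0 < K)%N)
  (d : measure_display) (T : measurableType d) (P : probability T R)
  (mu : 'I_K -> T -> R) (X : 'I_K -> nat -> T -> bool) (A : nat -> T -> 'I_K)
  (* measurability of the random variables *)
  (mu_meas : forall i, measurable_fun setT (mu i))
  (X_meas : forall i n, measurable [set w | X i n w])
  (A_meas : forall t i, measurable [set w | A t w = i])
  (* mean rewards lie in [0,1] *)
  (mu01 : forall i, P [set w | 0 <= mu i w <= 1] = 1%E)
  (* the mean rewards mu_1, ..., mu_K are independent (priors P_i = laws of mu_i) *)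
  (mu_indep : forall B : 'I_K -> set R, (forall k, measurable (B k)) ->
     fine (P [set w | forall k, B k (mu k w)]) =
     \prod_(k < K) fine (P [set w | B k (mu k w)]))
  (* given the means, the samples X i n are independent Bernoulli(mu i) *)
  (X_bern : forall (B : 'I_K -> set R) (S : seq ('I_K * nat)) (x : 'I_K -> nat -> bool),
     (forall k, measurable (B k)) -> uniq S ->
     P (cylinder mu X B S x) =
     (\int[P]_(w in [set w | forall k, B k (mu k w)])
        (\prod_(p <- S) (if x p.1 p.2 then mu p.1 w else 1 - mu p.1 w))%:E)%E)
  (* Thompson sampling (agents follow recommendations, chosen arm = A t):
     given the history F_t, A t is independent of (mu, X) and
     Pr[A t = i | F_t] = Pr[A^* = i | F_t] *)
  (TS : forall (t : nat) (i : 'I_K) (h : seq ('I_K * bool))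
          (B : 'I_K -> set R) (S : seq ('I_K * nat)) (x : 'I_K -> nat -> bool),
     (forall k, measurable (B k)) ->
     (P ([set w | A t w = i /\ history X A t w = h] `&` cylinder mu X B S x)
        * P [set w | history X A t w = h] =
      P [set w | is_best mu w i /\ history X A t w = h]
        * P ([set w | history X A t w = h] `&` cylinder mu X B S x))%E)
  (* equal prior means *)
  (eqmeans : forall i j, (\int[P]_w (mu i w)%:E = \int[P]_w (mu j w)%:E)%E) :
  (* BIC *)
  forall (t : nat) (i j : 'I_K),
    (0 < P [set w | A t w = i])%E ->
    0 <= cond_exp_event P (fun w => mu i w - mu j w) [set w | A t w = i].
Proof.
(* The means lie in [0, 1] only almost surely, while the pointwise bounds on likelihoods need it
   everywhere. Clipping changes them on a null set, and every hypothesis is carried over to [nu]. *)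
pose nu k w := clip (mu k w).
have nu_meas k : measurable_fun setT (nu k) by exact: measurable_clip.
have nu01 k w : 0 <= nu k w <= 1 by exact: clip01.
have nu_ae : {ae P, forall w, forall k, nu k w = mu k w}.
  apply: filter_forall => k.
  have mk : measurable [set w | 0 <= mu k w <= 1].
    have -> : [set w | 0 <= mu k w <= 1] = mu k @^-1` `[0, 1].
      by apply/seteqP; split => w /=; rewrite in_itv.
    by rewrite -[X in measurable X]setTI; apply: mu_meas => //; exact: measurable_itv.
  by apply: filterS (ae_of_probability1 mk (mu01 k)) => w; exact: clip_id.
have mrect (m : 'I_K -> T -> R) B : (forall k, measurable_fun setT (m k)) ->
    (forall k, measurable (B k)) -> measurable [set w | forall k, B k (m k w)].
  by move=> mm mB; exact (measurable_rectangle mm mB).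
have rect_ae B : {ae P, forall w,
    (forall k, B k (nu k w)) <-> (forall k, B k (mu k w))}.
  by apply: filterS nu_ae => w E; split => H k; have := H k; rewrite E.
have cyl_ae B S x : {ae P, forall w,
    cylinder nu X B S x w <-> cylinder mu X B S x w}.
  by apply: filterS (rect_ae B) => w [E1 E2]; split => -[H1 H2]; split => //;
    [exact: E1|exact: E2].
have best_ae i : {ae P, forall w, is_best nu w i <-> is_best mu w i}.
  by apply: filterS nu_ae => w E; split=> -[H1 H2]; split => k;
    [have := H1 k|have := H2 k|have := H1 k|have := H2 k]; rewrite !E.
have mhist t h : measurable [set w | history X A t w = h].
  have [ht|ht] := eqVneq (size h) t.
    have := measurable_history_event X_meas A_meas (rev h).
    by rewrite /history_event size_rev ht revK.
  (* [TS] ranges over all lists [h]; one of length other than [t] is never the history. *)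
  have -> : [set w | history X A t w = h] = set0.
    apply/seteqP; split => w //= E; move: ht.
    by rewrite -E size_history eqxx.
  exact: measurable0.
have mAhist t i h : measurable [set w | A t w = i /\ history X A t w = h].
  exact: (measurableI _ _ (A_meas t i) (mhist t h)).
have nu_indep B : (forall k, measurable (B k)) ->
    fine (P [set w | forall k, B k (nu k w)]) =
    \prod_(k < K) fine (P [set w | B k (nu k w)]).
  move=> mB; rewrite (probability_ae_eq (mrect nu B nu_meas mB)
    (mrect mu B mu_meas mB) (rect_ae B)) mu_indep//.
  apply: eq_bigr => k _; congr fine; apply: probability_ae_eq.
  - by have := mu_meas k measurableT (B k) (mB k); rewrite setTI.
  - by have := nu_meas k measurableT (B k) (mB k); rewrite setTI.
  - by apply: filterS nu_ae => w E; rewrite /= E.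
have mcyl (m : 'I_K -> T -> R) B S x : (forall k, measurable_fun setT (m k)) ->
    (forall k, measurable (B k)) -> measurable (cylinder m X B S x).
  by move=> mm mB; exact: measurable_cylinder.
have mprod (m : 'I_K -> T -> R) (S : seq ('I_K * nat)) (x : 'I_K -> nat -> bool) :
    (forall k, measurable_fun setT (m k)) -> measurable_fun setT
    (fun w => \prod_(p <- S) (if x p.1 p.2 then m p.1 w else 1 - m p.1 w)).
  move=> mm; apply: measurable_prod => p _; case: (x p.1 p.2) => //.
  by apply: measurable_funB => //; exact: measurable_cst.
have nu_bern B S x : (forall k, measurable (B k)) -> uniq S ->
    P (cylinder nu X B S x) =
    (\int[P]_(w in [set w | forall k, B k (nu k w)])
       (\prod_(p <- S) (if x p.1 p.2 then nu p.1 w else 1 - nu p.1 w))%:E)%E.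
  move=> mB uS; rewrite (probability_ae_eq (mcyl nu B S x nu_meas mB)
    (mcyl mu B S x mu_meas mB) (cyl_ae B S x)) X_bern//.
  apply: integral_ae_eq_set; [exact: mrect|exact: mrect|exact: mprod|exact: mprod|].
  apply: filterS2 nu_ae (rect_ae B) => w E /= [H1 H2]; split; first by split.
  by apply: eq_bigr => p _; rewrite E.
have nu_TS t i h B S x : (forall k, measurable (B k)) ->
    (P ([set w | A t w = i /\ history X A t w = h] `&` cylinder nu X B S x)
       * P [set w | history X A t w = h] =
     P [set w | is_best nu w i /\ history X A t w = h]
       * P ([set w | history X A t w = h] `&` cylinder nu X B S x))%E.
  move=> mB.
  have eqI (D C C' : set T) : measurable D -> measurable C -> measurable C' ->
      {ae P, forall w, C w <-> C' w} -> P (D `&` C) = P (D `&` C').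
    move=> mD mC mC' CC'; apply: probability_ae_eq; [exact: measurableI..|].
    by apply: filterS CC' => w [C1 C2]; split => -[Dw Cw]; split => //;
      [exact: C1|exact: C2].
  have cylE D : measurable D ->
      P (D `&` cylinder nu X B S x) = P (D `&` cylinder mu X B S x).
    by move=> mD; apply: eqI => //; exact: mcyl.
  have bestE : P [set w | is_best nu w i /\ history X A t w = h] =
               P [set w | is_best mu w i /\ history X A t w = h].
    have := eqI _ _ _ (mhist t h) (measurable_best nu_meas i)
      (measurable_best mu_meas i) (best_ae i).
    by rewrite ![_ `&` [set w | is_best _ w i]]setIC.
  by rewrite !cylE// bestE TS.
have nu_means k l : ex P (nu k) = ex P (nu l).
  have E m : (\int[P]_w (nu m w)%:E = \int[P]_w (mu m w)%:E)%E.
    by apply: integral_ae_eq_set => //; apply: filterS nu_ae => w E; rewrite E.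
  by rewrite /ex /Rintegral !E (eqmeans k l).
(* The conditioning probability is nonnegative, so only the sign of the unnormalised integral
   matters. *)
move=> t i j _; apply: divr_ge0; last exact: fine_ge0.
have E : (\int[P]_(w in [set w | A t w = i]) (nu i w - nu j w)%:E =
          \int[P]_(w in [set w | A t w = i]) (mu i w - mu j w)%:E)%E.
  apply: integral_ae_eq_set => //; try exact: measurable_funB.
  by apply: filterS nu_ae => w E; rewrite !E.
have := ex_diff_recommended_ge0 hK nu_meas nu01 nu_indep X_meas A_meas nu_bern
  nu_TS nu_means t i j.
by rewrite ex_mul_indic /Rintegral E.
Qed.
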